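(* Let $n \ge 1$ and $m \ge 1$ be integers, let $\lambda > 1$ be a real number, and let the coefficients $a_\alpha$, $a$, $b$ be as in the context. Suppose that for some real number $\sigma > 1$, $$\int_1^\infty r^{(m - n)\lambda + n - 1} q(r)\, dr = \infty, \qquad \text{where } q(r) = \mathop{\rm ess\,inf}_{B_{\sigma r} \setminus B_{r/\sigma}} a^{-\lambda} b .$$ Then every solution $u$ of the inequality $$\sum_{|\alpha| = m} (-1)^m \partial^\alpha a_\alpha(x, u) \ge b(x) |u|^\lambda \quad \text{in } \mathbb{R}^n$$ is trivial, i.e. $u(x) = 0$ for almost all $x \in \mathbb{R}^n$.
   Context: For each multi-index $\alpha = (\alpha_1,\dots,\alpha_n)$ with $|\alpha| = \alpha_1 + \dots + \alpha_n = m$, $a_\alpha : \mathbb{R}^n \times \mathbb{R} \to \mathbb{R}$ is a given function, and $\partial^\alpha = \partial^{|\alpha|}/\partial x_1^{\alpha_1}\cdots\partial x_n^{\alpha_n}$. The function $b : \mathbb{R}^n \to (0,\infty)$ is measurable and positive, and there is a positive measurable function $a : \mathbb{R}^n \to (0,\infty)$ such that $|a_\alpha(x,\zeta)| \le a(x)|\zeta|$ for almost all $x \in \mathbb{R}^n$, all $\zeta \in \mathbb{R}$ and all $|\alpha| = m$. $B_r$ denotes the open ball in $\mathbb{R}^n$ of radius $r>0$ centered at the origin. A function $u$ is called a solution of the inequality if $b(x)|u|^\lambda \in L_{1,loc}(\mathbb{R}^n)$, $a_\alpha(x,u) \in L_{1,loc}(\mathbb{R}^n)$ for all $|\alpha|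 = m$, and $$\int_{\mathbb{R}^n} \sum_{|\alpha|=m} a_\alpha(x,u)\, \partial^\alpha \varphi \, dx \ge \int_{\mathbb{R}^n} b(x)|u|^\lambda \varphi\, dx$$ for every non-negative $\varphi \in C_0^\infty(\mathbb{R}^n)$. *)

(* Defs.v *)
From HB Require Import structures.
From mathcomp Require Import all_boot all_order all_algebra.
From mathcomp Require Import all_classical all_reals all_analysis.
Set Implicit Arguments. Unset Strict Implicit. Unset Printing Implicit Defensive.
Import Order.TTheory GRing.Theory Num.Theory.
Import numFieldNormedType.Exports.
Local Open Scope classical_set_scope.
Local Open Scope ring_scope.

Section Rn.
Variable R : realType.

Record msp := MSp {
  msp_disp : measure_display;
  msp_car : measurableType msp_disp;
  msp_meas : {measure set msp_car -> \bar R} }.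

(* leb_space k = (R^(k+1), product of k+1 copies of Lebesgue measure on R),
   realised as nested pairs ((..(R * R) * ..) * R). *)
Fixpoint leb_space (k : nat) : msp :=
  match k with
  | 0 => @MSp _ _ (@lebesgue_measure R)
  | k'.+1 => @MSp _ ((msp_car (leb_space k')) * measurableTypeR R)%type
               (((msp_meas (leb_space k')) \x (@lebesgue_measure R))%E
                 : {measure set _ -> \bar R})
  end.

Fixpoint coord (k : nat) : msp_car (leb_space k) -> nat -> R :=
  match k return msp_car (leb_space k) -> nat -> R with
  | 0 => fun y _ => y
  | k'.+1 => fun y i => if i == k'.+1 then y.2 else coord y.1 i
  end.

(* The measure space R^n (n >= 1 intended) and the identification with 'rV_n *)
Definition Rn_space (n : nat) := msp_car (leb_space n.-1).
Definition lebn (n : nat) : {measure set Rn_space n -> \bar R} :=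
  msp_meas (leb_space n.-1).
Definition of_nested (n : nat) (y : Rn_space n) : 'rV[R]_n :=
  \row_(i < n) coord y i.

Definition eucl (n : nat) (x : 'rV[R]_n) : R := Num.sqrt (\sum_(i < n) x 0 i ^+ 2).

Definition ae_Rn (n : nat) (P : 'rV[R]_n -> Prop) : Prop :=
  \forall y \ae (lebn n), P (of_nested y).

(* Lebesgue measurability: a.e. equal to a Borel-measurable function *)
Definition Rn_measurable (n : nat) (f : 'rV[R]_n -> R) : Prop :=
  exists g : 'rV[R]_n -> R,
    measurable_fun setT (g \o @of_nested n) /\ ae_Rn (fun x => f x = g x).

Definition integral_Rn (n : nat) (f : 'rV[R]_n -> R) : \bar R :=
  (\int[lebn n]_y (f (of_nested y))%:E)%E.

Definition Lloc1 (n : nat) (f : 'rV[R]_n -> R) : Prop :=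
  Rn_measurable f /\
  forall r : R, 0 < r ->
    (\int[lebn n]_(y in [set y | (eucl (of_nested y) < r)%R])
        (`|f (of_nested y)|)%:E < +oo)%E.

Definition partial (n : nat) (i : 'I_n) (f : 'rV[R]_n -> R) : 'rV[R]_n -> R :=
  fun x => 'D_(delta_mx 0 i) f x.

Definition smooth (n : nat) (f : 'rV[R]_n -> R) : Prop :=
  forall (s : seq 'I_n) (x : 'rV[R]_n),
    differentiable (foldr (@partial n) f s) x.

Definition nonneg_test_fun (n : nat) (phi : 'rV[R]_n -> R) : Prop :=
  smooth phi /\ (forall x, 0 <= phi x) /\
  exists r : R, forall x, r < eucl x -> phi x = 0.

Definition multi_index (n m : nat) := {ffun 'I_n -> 'I_m.+1}.
Definition mi_deg (n m : nat) (al : multi_index n m) : nat := (\sum_(i < n) (al i : nat))%N.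

Definition mpartial (n m : nat) (al : multi_index n m) (f : 'rV[R]_n -> R) :=
  foldr (fun i g => iter (al i) (partial i) g) f (enum 'I_n).

Definition ball_Rn (n : nat) (r : R) : set 'rV[R]_n := [set x | eucl x < r].
Definition annulus (n : nat) (s r : R) : set 'rV[R]_n :=
  @ball_Rn n (s * r) `\` @ball_Rn n (r / s).

Definition ess_inf_on (n : nat) (E : set 'rV[R]_n) (f : 'rV[R]_n -> R) : \bar R :=
  ereal_sup [set c : \bar R | ae_Rn (fun x => E x -> (c <= (f x)%:E)%E)].

(* u is a (weak) solution of  sum_{|alpha|=m} (-1)^m d^alpha a_alpha(x,u) >= b |u|^lambda *)
Definition is_solution (n m : nat) (A : multi_index n m -> 'rV[R]_n -> R -> R)
    (b : 'rV[R]_n -> R) (lam : R) (u : 'rV[R]_n -> R) : Prop :=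
  Lloc1 (fun x => b x * `|u x| `^ lam) /\
  (forall al : multi_index n m, mi_deg al = m -> Lloc1 (fun x => A al x (u x))) /\
  forall phi : 'rV[R]_n -> R, nonneg_test_fun phi ->
    (integral_Rn (fun x => b x * `|u x| `^ lam * phi x)%R
     <= integral_Rn (fun x => \sum_(al : multi_index n m | mi_deg al == m)
                                A al x (u x) * mpartial al phi x)%R)%E.

End Rn.

(* Main.v *)
(* Put g = b|u|^lam and E(r) = \int_{B_r} g.  Test the inequality with
   phi(x) = chi(x/r)^N, where chi = 1 on B_{1/sigma}, chi = 0 off B_sigma and N
   is so large that |d^alpha phi| <= K r^-m phi^(1/lam).  Only the annulus
   B_{sigma r} \ B_{r/sigma} contributes on the left, and there a|u| is at most
   (g/c)^(1/lam) for every essential lower bound c of a^-lam b; so Hoelder's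
   inequality bounds F = \int g phi by
     c r^((m-n)lam+n) F^lam <= C (F - E(r/sigma)),
   with E(r/sigma) <= F <= E(sigma r).  If E(r/sigma) > 0, convexity of
   t^(1-lam) turns this into
     c r^((m-n)lam+n) <= C' (E(r/sigma)^(1-lam) - E(sigma r)^(1-lam)),
   whose sum over the intervals [sigma^i, sigma^(i+1)) telescopes, contradicting
   the divergence of the integral.  On the finitely many early intervals, where
   E may vanish, q is bounded because an annulus has positive measure. *)

Require Import Defs.
From HB Require Import structures.
From mathcomp Require Import all_boot all_order all_algebra.
From mathcomp Require Import all_classical all_reals all_analysis.
From mathcomp Require Import measurable_realfun ring lra.
Set Implicit Arguments. Unset Strict Implicit. Unset Printing Implicit Defensive.
Import Order.TTheory GRing.Theory Num.Theory.
Import numFieldNormedType.Exports.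
Local Open Scope classical_set_scope.
Local Open Scope ring_scope.

(** * Smooth functions and cut-offs *)

(** The polynomial in 1/t is carried along so that the family is closed under differentiation; p = 1
    gives the classical function exp(-1/t), flat at 0. *)
Definition flat {R : realType} (p : {poly R}) (t : R) : R :=
  if 0 < t then p.[t^-1] * expR (- t^-1) else 0.

(** With y = 1/t, the chain rule turns p(y) exp(-y) into y^2 (p(y) - p'(y)) exp(-y). *)
Definition flat_deriv {R : realType} (p : {poly R}) : {poly R} :=
  'X^2 * (p - p^`()).

(** For y = 1/t >= 1, p(y) grows at most like y^(size p) while exp(-y) <= d!/y^d with d = size p +
    2, so two powers of t are left over. This quadratic decay gives the zero derivative at the
    origin. *)
Lemma flat_le_sqr (R : realType) (p : {poly R}) :
  exists C : R, forall t, `|t| <= 1 -> `|flat p t| <= C * t ^+ 2.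
Proof.
pose S := \sum_(i < size p) `|p`_i|.
pose d := (size p).+2.
exists (S * d`!%:R) => t t1.
have S0 : 0 <= S by apply: sumr_ge0.
rewrite /flat; case: ifPn => [t0|_]; last first.
  by rewrite normr0 mulr_ge0 ?sqr_ge0// mulr_ge0.
move: t1; rewrite gtr0_norm// => t1.
set y := t^-1.
have y1 : 1 <= y by rewrite invf_ge1.
have y0 : 0 < y by rewrite invr_gt0.
have pS : `|p.[y]| <= S * y ^+ size p.
  rewrite horner_coef (le_trans (ler_norm_sum _ _ _))// /S mulr_suml.
  apply: ler_sum => i _; rewrite normrM ler_wpM2l//.
  by rewrite normrX gtr0_norm// ler_weXn2l// ltnW.
have eS : expR (- y) <= d`!%:R / y ^+ d.
  rewrite expRN -[leRHS]invf_div lef_pV2 ?posrE ?expR_gt0//; last first.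
    by rewrite divr_gt0 ?exprn_gt0// ltr0n fact_gt0.
  by rewrite (le_trans _ (@expR_ge1Dxn R y (size p).+1 (ltW y0)))// ler_wpDl.
rewrite normrM (gtr0_norm (expR_gt0 _)).
apply: (le_trans (ler_pM _ _ pS eS)); rewrite ?expR_ge0//.
rewrite -[t]invrK -/y /d 2!exprSr.
rewrite le_eqVlt; apply/orP; left; apply/eqP; field.
by rewrite expf_neq0 gt_eqF.
Qed.

Lemma is_derive_flat (R : realType) (p : {poly R}) (t : R) :
  is_derive t 1 (flat p) (flat (flat_deriv p) t).
Proof.
have [t0|t0|->] := ltgtP t 0.
- rewrite {2}/flat ltNge (ltW t0)/=.
  apply: (@near_eq_is_derive _ _ _ (cst 0)).
  near=> s; rewrite /flat ltNge ifF//; apply/negbTE; rewrite negbK//.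
  by near: s; exact: lt_le_nbhsl.
- pose f := (horner p \o GRing.inv) * (expR \o (fun s : R => - s^-1)).
  apply: (@near_eq_is_derive _ _ _ f).
    by near=> s; rewrite /flat ifT//; near: s; exact: lt_nbhsr.
  have tn0 : t != 0 by rewrite gt_eqF.
  have dV : is_derive t 1 (@GRing.inv R) (- t ^- 2 *: 1).
    by apply: (@is_deriveV R id t 1 1) => //; exact: is_derive_id.
  have dN : is_derive t 1 (fun s : R => - s^-1) (- (- t ^- 2 *: 1)).
    exact: (is_deriveN dV).
  have := is_deriveM (is_derive1_comp (is_derive_poly p t^-1) dV)
                     (@is_derive1_comp R expR (fun s => - s^-1) t _ _
                        (is_derive_expR _) dN).
  move=> df; apply: (is_derive_eq df).
  rewrite /flat t0 /flat_deriv /= !hornerE /= /GRing.scale/= !exprVn.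
  by ring.
- rewrite {2}/flat ltxx; have [C HC] := flat_le_sqr p.
  apply/is_derive1_caratheodory; exists (fun s => flat p s / s); split.
  (* The difference quotient at 0 is [flat p s / s], of size at most C |s|; division by zero gives
     it the right value 0 at s = 0. *)
  + move=> s; rewrite subr0 {2}/flat ltxx subr0.
    have [->|s0] := eqVneq s 0; first by rewrite /flat ltxx !mul0r.
    by rewrite divfK.
  + rewrite /prop_for /continuous_at /= invr0 mulr0.
    apply/cvgr0Pnorm_le => /= e e0.
    near=> s; have s1 : `|s| <= 1 by near: s; apply: (@nbhs0_le _ R^o _ ltr01).
    have [->|s0] := eqVneq s 0; first by rewrite invr0 mulr0 normr0 ltW.
    rewrite normrM normfV ler_pdivrMr ?normr_gt0//.
    apply: (le_trans (HC _ s1)).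
    rewrite -real_normK ?num_real// expr2 mulrA ler_wpM2r//.
    have : (`|C| + 1) * `|s| <= e.
      rewrite mulrC -ler_pdivlMr; last by rewrite ltr_wpDl.
      by near: s; apply: (@nbhs0_le _ R^o); rewrite divr_gt0// ltr_wpDl.
    apply: le_trans; rewrite ler_wpM2r// (le_trans (ler_norm _))//.
    by rewrite lerDl.
  + by rewrite invr0 mulr0.
Unshelve. all: by end_near. Qed.

(* Closed under partial derivatives, so every member is smooth. *)
Inductive smooth_expr {R : realType} {n : nat} : ('rV[R]_n -> R) -> Prop :=
| SmCst c : smooth_expr (fun=> c)
| SmCoord i : smooth_expr (fun x => x 0 i)
| SmAdd f g : smooth_expr f -> smooth_expr g -> smooth_expr (fun x => f x + g x)
| SmMul f g : smooth_expr f -> smooth_expr g -> smooth_expr (fun x => f x * g x)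
| SmInv f : smooth_expr f -> (forall x, 0 < f x) ->
    smooth_expr (fun x => (f x)^-1)
| SmFlat p f : smooth_expr f -> smooth_expr (fun x => flat p (f x)).

Section SmoothExpr.
Context {R : realType} {n : nat}.
Implicit Types f g : 'rV[R]_n -> R.

Lemma smooth_expr_differentiable f : smooth_expr f ->
  forall x, differentiable f x.
Proof.
elim=> {f} [c|i|f g _ df _ dg|f g _ df _ dg|f _ df f0|p f _ df] x.
- exact: differentiable_cst.
- exact: differentiable_coord.
- exact: differentiableD.
- exact: differentiableM.
- by apply: differentiableV; rewrite ?gt_eqF.
- apply: (@differentiable_comp _ _ _ _ f (flat p)) => //.
  by apply/derivable1_diffP; apply: ex_derive; exact: is_derive_flat.
Qed.

Lemma smooth_expr_derivable f x v : smooth_expr f -> derivable f x v.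
Proof. by move=> sf; exact/diff_derivable/smooth_expr_differentiable. Qed.

Lemma partial_mul i f g x : smooth_expr f -> smooth_expr g ->
  partial i (fun x => f x * g x) x = f x * partial i g x + g x * partial i f x.
Proof.
by move=> sf sg; rewrite /partial [LHS]deriveM//; exact: smooth_expr_derivable.
Qed.

Lemma smooth_expr_partial f : smooth_expr f ->
  forall i, smooth_expr (partial i f).
Proof.
elim=> {f} [c|j|f g sf df sg dg|f g sf df sg dg|f sf df f0|p f sf df] i.
- rewrite (_ : partial i _ = fun=> 0); first exact: SmCst.
  by apply/funext => x; rewrite /partial derive_cst.
- rewrite (_ : partial i _ = fun=> (i == j)%:R); first exact: SmCst.
  apply/funext => x; rewrite /partial /derive.
  apply: cvg_lim => //; apply: cvg_near_cst.
  near=> h; rewrite /= !mxE eqxx/= [i == j]eq_sym addrK.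
  rewrite /GRing.scale/= mulrA mulVf ?mul1r//.
  by near: h; exact: nbhs_dnbhs_neq.
- rewrite (_ : partial i _ = fun x => partial i f x + partial i g x).
    by apply: SmAdd; [exact: df|exact: dg].
  apply/funext => x; rewrite /partial [LHS]deriveD//; exact: smooth_expr_derivable.
- rewrite (_ : partial i _ = fun x => f x * partial i g x + g x * partial i f x).
    by apply: SmAdd; apply: SmMul.
  by apply/funext => x; rewrite partial_mul.
- rewrite (_ : partial i _ = fun x => -1 * ((f x)^-1 * (f x)^-1) * partial i f x).
    by do 2?[apply: SmMul => //]; [exact: SmCst|apply: SmMul; exact: SmInv].
  apply/funext => x; rewrite /partial deriveV ?gt_eqF//; last first.
    exact: smooth_expr_derivable.
  by rewrite /GRing.scale/= expr2 invfM mulN1r.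
- rewrite (_ : partial i _ = fun x => flat (flat_deriv p) (f x) * partial i f x).
    by apply: SmMul => //; apply: SmFlat.
  apply/funext => x.
  have dfx := smooth_expr_differentiable sf x.
  have [dp Dp] := is_derive_flat p (f x).
  have dpx : differentiable (flat p) (f x) by apply/derivable1_diffP.
  rewrite /partial deriveE; last exact: (@differentiable_comp _ _ _ _ f (flat p)).
  by rewrite (@diff_comp _ _ _ _ f (flat p))//= diff1E// derive1E Dp deriveE// mulrC.
Unshelve. all: by end_near. Qed.

Lemma smooth_expr_foldr f s : smooth_expr f ->
  smooth_expr (foldr (@partial R n) f s).
Proof. by move=> sf; elim: s => //= i s; move/smooth_expr_partial; apply. Qed.

Lemma smooth_expr_smooth f : smooth_expr f -> smooth f.
Proof. by move=> sf s x; exact/smooth_expr_differentiable/smooth_expr_foldr. Qed.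

Lemma smooth_expr_continuous f : smooth_expr f -> continuous f.
Proof.
by move=> sf x; exact/differentiable_continuous/smooth_expr_differentiable.
Qed.

Lemma smooth_expr_scale f c : smooth_expr f ->
  smooth_expr (fun x => f (c *: x)).
Proof.
elim=> {f} [d|i|f g _ df _ dg|f g _ df _ dg|f _ df f0|p f _ df].
- exact: SmCst.
- under eq_fun do rewrite mxE; exact: (SmMul (SmCst c) (SmCoord i)).
- exact: SmAdd df dg.
- exact: SmMul df dg.
- by apply: SmInv df _.
- exact: SmFlat df.
Qed.

Lemma smooth_expr_X f k : smooth_expr f -> smooth_expr (fun x => f x ^+ k).
Proof.
move=> sf; elim: k => [|k ih]; first exact: SmCst.
under eq_fun do rewrite exprS; exact: SmMul.
Qed.

Lemma partial_X i f k x : smooth_expr f ->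
  partial i (fun x => f x ^+ k.+1) x = k.+1%:R * f x ^+ k * partial i f x.
Proof.
move=> sf; elim: k => [|k ih].
  under eq_fun do rewrite expr1.
  by rewrite expr0 !mul1r.
under eq_fun do rewrite exprS.
rewrite partial_mul//; last exact: smooth_expr_X.
by rewrite ih exprS -[k.+2%:R]natr1; ring.
Qed.

Lemma smooth_expr_sum (I : Type) (r : seq I) (F : I -> 'rV[R]_n -> R) :
  (forall i, smooth_expr (F i)) -> smooth_expr (fun x => \sum_(i <- r) F i x).
Proof.
move=> sF; elim: r => [|i r ih].
  by under eq_fun do rewrite big_nil; exact: SmCst.
by under eq_fun do rewrite big_cons; exact: SmAdd.
Qed.

Lemma partial_scale i f c d : smooth_expr f ->
  partial i (fun x => d * f (c *: x)) =
  fun x => d * c * partial i f (c *: x).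
Proof.
move=> sf; apply/funext => x.
have sfc := smooth_expr_scale c sf.
rewrite partial_mul//; last exact: SmCst.
have -> : partial i (fun=> d) x = 0 by rewrite /partial derive_cst.
rewrite mulr0 addr0 -mulrA; congr (_ * _).
rewrite /partial !deriveE//; last 2 first.
- exact: smooth_expr_differentiable.
- exact: smooth_expr_differentiable.
have dscale : is_diff x ( *:%R c : 'rV[R]_n -> 'rV[R]_n) ( *:%R c).
  exact: is_diff_scaler.
have df : is_diff (c *: x) f ('d f (c *: x)).
  exact/differentiableP/smooth_expr_differentiable.
have dcomp := is_diff_comp dscale df.
have linZ (L : {linear 'rV[R]_n -> R}) v : L (c *: v) = c * L v.
  by rewrite linearZ.
have dE := congr1 (@^~ (delta_mx 0 i)) (@diff_val _ _ _ _ _ _ _ dcomp).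
apply: (etrans dE).
exact: linZ.
Qed.

Lemma foldr_partial_scale f c s : smooth_expr f ->
  foldr (@partial R n) (fun x => f (c *: x)) s =
  fun x => c ^+ size s * foldr (@partial R n) f s (c *: x).
Proof.
move=> sf; elim: s => [|i s ih] /=; first by under [RHS]eq_fun do rewrite mul1r.
by rewrite ih partial_scale ?exprSr//; exact: smooth_expr_foldr.
Qed.

(** Each derivative uses up at most one factor f, so [size s] derivatives of f^(k + size s) keep a
    factor f^k. *)
Lemma foldr_partial_X f k s : smooth_expr f -> exists2 h, smooth_expr h &
  foldr (@partial R n) (fun x => f x ^+ (k + size s)) s = fun x => f x ^+ k * h x.
Proof.
move=> sf; elim: s k => [|i s ih] k /=.
  exists (fun=> 1); first exact: SmCst.
  by under [RHS]eq_fun do rewrite mulr1; rewrite addn0.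
(* The induction hypothesis at k + 1 leaves one spare factor f for the outermost derivative. *)
have [h sh hE] := ih k.+1; rewrite addnS -addSn hE.
exists (fun x => f x * partial i h x + (k.+1%:R * partial i f x) * h x).
  apply: SmAdd; first by apply: SmMul => //; exact: smooth_expr_partial.
  by apply: SmMul => //; apply: SmMul; [exact: SmCst|exact: smooth_expr_partial].
apply/funext => x; rewrite partial_mul//; last exact: smooth_expr_X.
by rewrite partial_X// exprS; ring.
Qed.

Lemma foldr_partial_near_cst f c s x : s != [::] -> (\near x, f x = c) ->
  foldr (@partial R n) f s x = 0.
Proof.
have near0 d g i y : (\near y, g y = d) -> partial i g y = 0.
  move=> gd; rewrite /partial (@near_eq_derive _ _ _ g (cst d))// derive_cst//.
case: s => // i s _; elim: s i x => [|j s ih] i x fc /=; first exact: near0 fc.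
(* f equals c near every point of a neighbourhood of x, so the inner derivatives vanish on a whole
   neighbourhood and can be differentiated once more. *)
apply: (near0 0); move/nbhs_interior: fc.
by apply: filterS => y; exact: ih.
Qed.

(** Flattening a multi-index into a list of directions makes the list inductions above applicable to
    [mpartial]. *)
Lemma mpartial_foldr m (al : multi_index n m) : exists2 s : seq 'I_n,
  size s = mi_deg al & forall f, mpartial al f = foldr (@partial R n) f s.
Proof.
exists (flatten [seq nseq (al i) i | i <- enum 'I_n]).
  rewrite size_flatten /shape -map_comp /mi_deg sumnE big_map big_enum /=.
  by apply: eq_bigr => i _; rewrite size_nseq.
move=> f; rewrite /mpartial; elim: (enum _) => //= i s ->.
by rewrite foldr_cat; elim: (nat_of_ord (al i)) => //= k ->.
Qed.

End SmoothExpr.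

(** * Radial cut-offs and rescaled test functions *)

Section Cutoff.
Context {R : realType} {n : nat}.
Implicit Types x : 'rV[R]_n.

Lemma eucl_ge0 x : 0 <= eucl x.
Proof. exact: sqrtr_ge0. Qed.

Lemma eucl_sqr x : eucl x ^+ 2 = \sum_(i < n) x 0 i ^+ 2.
Proof. by rewrite sqr_sqrtr// sumr_ge0// => i _; exact: sqr_ge0. Qed.

Lemma eucl_scale (c : R) x : 0 <= c -> eucl (c *: x) = c * eucl x.
Proof.
move=> c0; apply/eqP; rewrite -(eqrXn2 (n := 2)) ?mulr_ge0 ?eucl_ge0//.
rewrite exprMn !eucl_sqr mulr_sumr; apply/eqP/eq_bigr => i _.
by rewrite mxE exprMn.
Qed.

Lemma smooth_expr_eucl_sqr : smooth_expr (fun x => eucl x ^+ 2).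
Proof.
under eq_fun do rewrite eucl_sqr.
by apply: smooth_expr_sum => i; exact/smooth_expr_X/SmCoord.
Qed.

Lemma near_eucl_lt (c : R) x : eucl x < c -> \near x, eucl x < c.
Proof.
move=> xc; have c0 : 0 <= c by rewrite ltW// (le_lt_trans (eucl_ge0 x)).
have sx : eucl x ^+ 2 < c ^+ 2 by rewrite ltrXn2r// ?eucl_ge0.
have cq : continuous (fun x => eucl x ^+ 2).
  exact: smooth_expr_continuous smooth_expr_eucl_sqr.
have := cq x; move=> /cvgr_lt/(_ _ sx); apply: filterS => y /=.
by rewrite ltr_pXn2r// ?nnegrE// eucl_ge0.
Qed.

Lemma continuous_bounded_ball (h : 'rV[R]_n -> R) (r : R) : continuous h ->
  exists C, forall x, eucl x <= r -> `|h x| <= C.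
Proof.
move=> ch; have [r0|r0] := ltP r 0.
  by exists 0 => x; rewrite leNgt (lt_le_trans r0 (eucl_ge0 x)).
(* The ball sits inside the cube [-r, r]^n, which is compact as a product of segments. *)
pose B := [set v : 'rV[R]_n | forall i, `[- r, r]%classic (v ord0 i)].
have cB : compact B.
  apply: (@rV_compact _ n (fun=> `[- r, r]%classic)) => _.
  exact: segment_compact.
have B0 : B !=set0.
  by exists 0 => i /=; rewrite mxE in_itv/= oppr_le0 r0.
have [] := @compact_EVT_max _ _ (fun x => `|h x|) _ B0 cB.
  apply: continuous_subspaceT => x; apply: cvg_comp; first exact: ch.
  exact: norm_continuous.
move=> c _ hc; exists `|h c| => x xr; apply: hc; rewrite inE => i /=.
rewrite in_itv/= -ler_norml -(ler_pXn2r (ltn0Sn 1)) ?nnegrE//.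
have : eucl x ^+ 2 <= r ^+ 2 by rewrite lerXn2r// nnegrE eucl_ge0.
apply: le_trans; rewrite eucl_sqr (bigD1 i)//= real_normK ?num_real// lerDl.
by apply: sumr_ge0 => j _; exact: sqr_ge0.
Qed.

Lemma flat1_ge0 (t : R) : 0 <= flat 1 t.
Proof. by rewrite /flat; case: ifP => // _; rewrite hornerC mul1r expR_ge0. Qed.

Lemma flat1_gt0 (t : R) : 0 < t -> 0 < flat 1 t.
Proof. by rewrite /flat => ->; rewrite hornerC mul1r expR_gt0. Qed.

Lemma flat1_le0 (t : R) : t <= 0 -> flat 1 t = 0.
Proof. by rewrite /flat ltNge => ->. Qed.

Lemma exists_cutoff (s1 s2 : R) : 0 <= s1 -> s1 < s2 ->
  exists chi : 'rV[R]_n -> R, [/\ smooth_expr chi,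
    forall x, 0 <= chi x <= 1, forall x, eucl x <= s1 -> chi x = 1 &
    forall x, s2 <= eucl x -> chi x = 0].
Proof.
move=> s10 s12; have s20 : 0 <= s2 by rewrite (le_trans s10)// ltW.
(* The cut-off is flat(u) / (flat(u) + flat(v)). Since s1 < s2, u or v is positive at every point,
   so the denominator never vanishes; v <= 0 on the inner ball and u <= 0 outside the outer one. *)
pose u x := s2 ^+ 2 + -1 * eucl x ^+ 2; pose v x := eucl x ^+ 2 + - s1 ^+ 2.
have su : smooth_expr u.
  apply: SmAdd; first exact: SmCst.
  by apply: SmMul; [exact: SmCst|exact: smooth_expr_eucl_sqr].
have sv : smooth_expr v.
  by apply: SmAdd; [exact: smooth_expr_eucl_sqr|exact: SmCst].
have den0 x : 0 < flat 1 (u x) + flat 1 (v x).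
  have [ux|ux] := ltP 0 (u x).
    by rewrite ltr_wpDr ?flat1_ge0// flat1_gt0.
  rewrite ltr_wpDl ?flat1_ge0// flat1_gt0//.
  have : s1 ^+ 2 < s2 ^+ 2 by rewrite ltrXn2r.
  by move: ux; rewrite /u /v; lra.
exists (fun x => flat 1 (u x) * (flat 1 (u x) + flat 1 (v x))^-1); split.
- apply: SmMul; first exact: SmFlat.
  by apply: SmInv => //; apply: SmAdd; exact: SmFlat.
- move=> x; rewrite divr_ge0 ?flat1_ge0 ?(ltW (den0 x))//=.
  by rewrite ler_pdivrMr// mul1r lerDl flat1_ge0.
- move=> x xs; have := den0 x; rewrite (@flat1_le0 (v x)) ?addr0.
    by move=> ux; rewrite divff// gt_eqF.
  by rewrite /v subr_le0 lerXn2r// nnegrE eucl_ge0.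
- move=> x xs; rewrite (@flat1_le0 (u x)) ?mul0r//.
  by rewrite /u mulN1r subr_le0 lerXn2r// nnegrE eucl_ge0.
Qed.

(* The power N of the cut-off is chosen so large that its m-th derivatives,
   which keep a factor chi^(N - m), are dominated by phi^(1/lam). *)
Lemma exists_test_fun (m : nat) (lam s1 s2 : R) : (0 < m)%N -> 1 < lam ->
  0 <= s1 -> s1 < s2 ->
  exists2 K : R, 0 <= K & exists phi : 'rV[R]_n -> R, [/\ smooth_expr phi,
    forall x, 0 <= phi x <= 1, forall x, eucl x <= s1 -> phi x = 1,
    forall x, s2 <= eucl x -> phi x = 0 &
    forall (al : multi_index n m), mi_deg al = m -> forall x,
      `|mpartial al phi x| <= K * phi x `^ lam^-1 /\
      (eucl x < s1 -> mpartial al phi x = 0)].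
Proof.
move=> m0 lam1 s10 s12; have lam0 : 0 < lam by rewrite (lt_trans ltr01).
have [chi [sc c01 c1 c0]] := exists_cutoff s10 s12.
(* This k satisfies k + m <= lam k, hence chi^k <= chi^((k + m)/lam) = phi^(1/lam) because 0 <= chi
   <= 1. *)
pose k := (Num.truncn (m%:R / (lam - 1))).+1.
have mk : m%:R <= (lam - 1) * k%:R.
  by rewrite mulrC -ler_pdivrMr ?subr_gt0// ltW// truncnS_gt.
pose phi x := chi x ^+ (k + m).
have chik x : chi x ^+ k <= phi x `^ lam^-1.
  have /andP[cx0 cx1] := c01 x.
  have [cx|cx] := eqVneq (chi x) 0; first by rewrite cx expr0n/= powR_ge0.
  rewrite /phi -!powR_mulrn// -powRrM ger_powR ?cx1 ?andbT ?lt0r ?cx//.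
  by rewrite ler_pdivrMr// natrD; move: mk; lra.
have KP0 (al : multi_index n m) : exists K, mi_deg al = m ->
    0 <= K /\ forall x, `|mpartial al phi x| <= K * chi x ^+ k.
  have [s ss sE] := @mpartial_foldr R n m al.
  have [h sh hE] := foldr_partial_X k s sc.
  have [C CP] := continuous_bounded_ball s2 (smooth_expr_continuous sh).
  exists `|C| => alm; split => // x; rewrite sE /phi -{1}alm -ss hE.
  have /andP[cx0 cx1] := c01 x.
  have [xs|xs] := leP s2 (eucl x); first by rewrite c0// expr0n/= mul0r normr0 mulr0.
  rewrite normrM ger0_norm ?exprn_ge0// mulrC ler_wpM2r ?exprn_ge0//.
  by rewrite (le_trans (CP _ (ltW xs)))// ler_norm.
have [K KP] := fin_all_exists KP0.
exists (\sum_(al | mi_deg al == m) K al).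
  by apply: sumr_ge0 => al /eqP /KP[].
exists phi; split.
- exact: smooth_expr_X.
- by move=> x; have /andP[? ?] := c01 x; rewrite exprn_ge0// exprn_ile1.
- by move=> x xs; rewrite /phi c1// expr1n.
- by move=> x xs; rewrite /phi c0// expr0n addn_eq0.
- move=> al alm x; have [K0 Kal] := KP al alm; split.
    rewrite (le_trans (Kal x))// ler_pM// ?exprn_ge0//.
      by have /andP[] := c01 x.
    rewrite (bigD1 al) ?alm//= lerDl sumr_ge0// => be /andP[/eqP /KP[]].
    by [].
  move=> xs; have [s ss ->] := @mpartial_foldr R n m al.
  apply: (foldr_partial_near_cst (c := 1)).
    by rewrite -size_eq0 ss alm -lt0n.
  by apply: filterS (near_eucl_lt xs) => y ys; rewrite /phi c1 ?expr1n// ltW.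
Qed.

(** A single profile is rescaled by x -> x/r, so K is the same for all r and the m derivatives
    produce the factor r^-m. *)
Lemma exists_scaled_test_fun (m : nat) (lam sigma : R) : (0 < m)%N ->
  1 < lam -> 1 < sigma ->
  exists2 K : R, 0 <= K & forall r, 0 < r ->
  exists phi : 'rV[R]_n -> R, [/\ smooth_expr phi,
    forall x, 0 <= phi x <= 1, forall x, eucl x < r / sigma -> phi x = 1,
    forall x, sigma * r <= eucl x -> phi x = 0 &
    forall (al : multi_index n m), mi_deg al = m -> forall x,
      `|mpartial al phi x| <= K / r ^+ m * phi x `^ lam^-1 /\
      (eucl x < r / sigma -> mpartial al phi x = 0)].
Proof.
move=> m0 lam1 sigma1; have sigma0 : 0 < sigma by rewrite (lt_trans ltr01).
have s12 : sigma^-1 < sigma by rewrite (lt_trans _ sigma1)// invf_lt1.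
have s0 : 0 <= sigma^-1 by rewrite invr_ge0 ltW.
have [K K0 [phi [sp p01 p1 p0 pD]]] := exists_test_fun m0 lam1 s0 s12.
exists K => // r r0; exists (fun x => phi (r^-1 *: x)).
have rV0 : 0 <= r^-1 by rewrite invr_ge0 ltW.
have in_lt x : eucl x < r / sigma -> eucl (r^-1 *: x) < sigma^-1.
  by move=> xr; rewrite eucl_scale// mulrC ltr_pdivrMr// mulrC.
split => //.
- exact: smooth_expr_scale.
- by move=> x /in_lt/ltW; exact: p1.
- by move=> x xr; apply: p0; rewrite eucl_scale// mulrC ler_pdivlMr.
- move=> al alm x; have [s ss sE] := @mpartial_foldr R n m al.
  rewrite sE foldr_partial_scale// -sE ss alm.
  have [pDx pD0] := pD al alm (r^-1 *: x); split; last first.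
    by move=> /in_lt /pD0 ->; rewrite mulr0.
  rewrite normrM (ger0_norm (exprn_ge0 _ rV0)) exprVn.
  by rewrite [K / _]mulrC -mulrA ler_wpM2l// invr_ge0 exprn_ge0// ltW.
Qed.

End Cutoff.

(** * Measures of cubes, balls and annuli *)

Section LebesgueRn.
Context {R : realType}.

Definition nested_cube (k : nat) (s t : R) : set (msp_car (leb_space R k)) :=
  [set y | forall i, (i <= k)%N -> `]s, t[%classic (Defs.coord y i)].

Arguments nested_cube : clear implicits.

Lemma nested_cubeS k s t :
  nested_cube k.+1 s t = nested_cube k s t `*` `]s, t[%classic.
Proof.
apply/seteqP; split => [y yC|y [y1 y2] i] /=.
  split; last by have := yC k.+1 (leqnn _); rewrite /= eqxx.
  move=> i ik; have := yC i (leqW ik).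
  by rewrite /= ltn_eqF// ltnS.
by rewrite leq_eqVlt; case: eqP => [_ _|_] //=; exact: y1.
Qed.

Lemma nested_cube0 s t : nested_cube 0 s t = `]s, t[%classic.
Proof.
apply/seteqP; split => [y /(_ 0%N (leqnn _))//|y yC i _]; exact: yC.
Qed.

Lemma measurable_nested_cube k s t : measurable (nested_cube k s t).
Proof.
elim: k => [|k ih]; first by rewrite nested_cube0; exact: measurable_itv.
by rewrite nested_cubeS; apply: measurableX => //; exact: measurable_itv.
Qed.

Lemma nested_cube_measure k s t : s <= t ->
  msp_meas (leb_space R k) (nested_cube k s t) = ((t - s) ^+ k.+1)%:E.
Proof.
move=> st; have itv_st : (@lebesgue_measure R) `]s, t[%classic = (t - s)%:E.
  rewrite lebesgue_measure_itv/= lte_fin.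
  by case: ltgtP st => // ->; rewrite subrr.
elim: k => [|k ih]; first by rewrite nested_cube0 expr1; exact: itv_st.
rewrite nested_cubeS /= product_measure1E//; last exact: measurable_nested_cube.
by rewrite ih [in RHS]exprSr EFinM; congr (_ * _)%E; exact: itv_st.
Qed.

Lemma measurable_coord k i :
  measurable_fun setT (fun y : msp_car (leb_space R k) => Defs.coord y i).
Proof.
elim: k => [|k ih] /=; first exact: measurable_id.
case: eqP => _; first exact: measurable_snd.
by apply: (measurableT_comp ih); exact: measurable_fst.
Qed.

Variable n : nat.

(** Measurability is carried up from the coordinates through the constructors, without comparing the
    topology of ['rV[R]_n] with that of the nested product. *)
Lemma smooth_expr_measurable (f : 'rV[R]_n -> R) : smooth_expr f ->
  measurable_fun setT (f \o @of_nested R n).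
Proof.
elim=> {f} [c|i|f g _ mf _ mg|f g _ mf _ mg|f _ mf f0|p f _ mf].
- exact: measurable_cst.
- apply: (eq_measurable_fun (fun y => Defs.coord y i)); last exact: measurable_coord.
  by move=> y _; rewrite /= mxE.
- exact: measurable_funD.
- exact: measurable_funM.
- apply: (eq_measurable_fun (fun y => f (of_nested y) `^ (-1))).
    by move=> y _; rewrite /= powR_inv1// ltW.
  exact: (measurableT_comp (measurable_powR (-1)) mf).
- apply: (@measurableT_comp _ _ _ _ _ _ (flat p) _ (f \o @of_nested R n)) => //.
  apply: continuous_measurable_fun => t.
  apply/differentiable_continuous/derivable1_diffP.
  by apply: ex_derive; exact: is_derive_flat.
Qed.

Definition nested_ball (r : R) : set (Rn_space R n) :=
  [set y | eucl (of_nested y) < r].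

Lemma measurable_nested_ball r : measurable (nested_ball r).
Proof.
have [r0|r0] := leP r 0.
  rewrite (_ : nested_ball r = set0) ?measurable0//; apply/seteqP; split => // y.
  by rewrite /nested_ball/= ltNge (le_trans r0) ?eucl_ge0.
have mq := smooth_expr_measurable smooth_expr_eucl_sqr.
rewrite (_ : nested_ball r = setT `&`
  ((fun x => eucl x ^+ 2) \o @of_nested R n) @^-1` `]-oo, r ^+ 2[%classic).
  by apply: mq => //; exact: measurable_itv.
rewrite setTI; apply/seteqP; split => y; rewrite /nested_ball/= in_itv/=.
  by move=> yr; rewrite ltrXn2r// ?eucl_ge0.
by rewrite ltr_pXn2r// nnegrE ?eucl_ge0 ?ltW.
Qed.

Hypothesis n0 : (0 < n)%N.

(** The ball lies in the cube ]-r, r[^n; only the order r^n matters for the scaling. *)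
Lemma nested_ball_measure r : 0 <= r ->
  (lebn R n (nested_ball r) <= ((r + r) ^+ n)%:E)%E.
Proof.
move=> r0; have := @nested_cube_measure n.-1 (- r) r.
rewrite opprK prednK// => <-; last by rewrite (le_trans _ r0)// oppr_le0.
apply: le_measure; rewrite ?inE; [exact: measurable_nested_ball| |].
  exact: measurable_nested_cube.
move=> y yr i; rewrite -ltnS prednK// => ni.
have : of_nested y 0 (Ordinal ni) ^+ 2 < r ^+ 2.
  rewrite (@le_lt_trans _ _ (eucl (of_nested y) ^+ 2))//; last first.
    by rewrite ltrXn2r// eucl_ge0.
  rewrite eucl_sqr (bigD1 (Ordinal ni))//= lerDl.
  by apply: sumr_ge0 => j _; exact: sqr_ge0.
rewrite mxE /= -real_normK ?num_real// ltr_pXn2r ?nnegrE//.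
by rewrite in_itv/= -ltr_norml.
Qed.

(** The annulus contains the cube of points whose coordinates all lie strictly between s/sqrt n and
    t/sqrt n, which has positive measure. *)
Lemma annulus_not_ae_empty (s t : R) : 0 <= s -> s < t ->
  ~ ae_Rn (fun x : 'rV[R]_n => ~ (s <= eucl x < t)).
Proof.
move=> s0 st [N [mN N0 sub]].
have nn0 : 0 < Num.sqrt n%:R :> R by rewrite sqrtr_gt0 ltr0n.
pose s' := s / Num.sqrt n%:R; pose t' := t / Num.sqrt n%:R.
have st' : s' < t' by rewrite ltr_pM2r// invr_gt0.
have s0' : 0 <= s' by rewrite divr_ge0// ltW.
have := @nested_cube_measure n.-1 s' t' (ltW st').
have -> : msp_meas (leb_space R n.-1) (nested_cube n.-1 s' t') = 0%E.
  apply: (@subset_measure0 _ _ _ (lebn R n) _ N) => //.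
    exact: measurable_nested_cube.
  move=> y yC; apply: sub => /=; apply.
  have yC' i : s' < of_nested y 0 i < t'.
    by rewrite mxE; have := yC i; rewrite -ltnS prednK//= in_itv/=; apply.
  have sq (c : R) : (c / Num.sqrt n%:R) ^+ 2 *+ n = c ^+ 2.
    rewrite exprMn exprVn sqr_sqrtr ?ler0n// -mulr_natr divfK//.
    by rewrite pnatr_eq0 -lt0n.
  have sumc (c : R) : \sum_(i < n) c = c *+ n by rewrite sumr_const card_ord.
  have t0' : 0 <= t' by rewrite ltW// (le_lt_trans s0').
  have t0 : 0 <= t by rewrite ltW// (le_lt_trans s0).
  apply/andP; split.
    rewrite -(ler_pXn2r (ltn0Sn 1)) ?nnegrE ?eucl_ge0// eucl_sqr -sq -sumc.
    apply: ler_sum => i _; have /andP[ys _] := yC' i.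
    by rewrite lerXn2r// ?nnegrE ?(ltW ys)// (le_trans s0')// ltW.
  rewrite -(ltr_pXn2r (ltn0Sn 1)) ?nnegrE ?eucl_ge0// eucl_sqr -sq -sumc.
  apply: ltr_sum.
    by apply/hasP; exists (Ordinal n0) => //; rewrite mem_index_enum.
  move=> i _; have /andP[ys yt] := yC' i.
  by rewrite ltrXn2r// (le_trans s0')// ltW.
move=> /esym/eqP; rewrite eqe expf_eq0/= subr_eq0.
by rewrite gt_eqF.
Qed.

End LebesgueRn.

(** * Integral inequalities *)

Section IntegralMonotone.
Local Open Scope ereal_scope.
Context d (T : measurableType d) (R : realType).
Variable mu : {measure set T -> \bar R}.
Import HBNNSimple.

(** The integral is a supremum over simple functions below the integrand. Cutting such a function to
    the complement of the exceptional null set keeps its integral and puts it below g everywhere. *)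
Lemma ge0_ae_le_integralT (f g : T -> \bar R) :
  (forall x, 0 <= f x) -> (forall x, 0 <= g x) ->
  (\forall x \ae mu, f x <= g x) -> \int[mu]_x f x <= \int[mu]_x g x.
Proof.
move=> f0 g0 [N [mN N0 fgN]].
rewrite !ge0_integralTE//; apply: ge_ereal_sup => _ [h /= hf <-].
have mNC : measurable (~` N) by exact: measurableC.
apply: (@le_trans _ _ (sintegral mu (proj_nnsfun h mNC))).
  rewrite -2!integralT_nnsfun le_eqVlt; apply/orP; left; apply/eqP.
  apply: ge0_ae_eq_integral => //.
  - exact/measurable_EFinP.
  - exact/measurable_EFinP.
  - by move=> x _; rewrite lee_fin.
  - by move=> x _; rewrite lee_fin.
  exists N; split => // x /= /not_implyP[_ hx].
  apply: contrapT => Nx; apply: hx.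
  by rewrite /= mindicE mem_set// mulr1.
apply: ereal_sup_ubound; exists (proj_nnsfun h mNC) => //= x.
rewrite mindicE; case: (boolP (x \in ~` N)) => xN; last by rewrite mulr0 g0.
rewrite mulr1 (le_trans (hf x))//; apply: contrapT => fgx.
by move: xN; rewrite inE; apply; exact: fgN.
Qed.

Lemma ge0_le_integral_nonmeasurable (D : set T) (f g : T -> \bar R) :
  (forall x, D x -> 0 <= f x) -> (forall x, D x -> f x <= g x) ->
  \int[mu]_(x in D) f x <= \int[mu]_(x in D) g x.
Proof.
move=> f0 fg; rewrite [leLHS]integral_mkcond [leRHS]integral_mkcond.
have g0 x : D x -> 0 <= g x by move=> Dx; exact: le_trans (f0 _ Dx) (fg _ Dx).
apply: ge0_ae_le_integralT.
- exact: erestrict_ge0.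
- exact: erestrict_ge0.
- by apply: aeW => x; exact: lee_restrict.
Qed.

Lemma ae_eq_integralT (f g : T -> \bar R) : (\forall x \ae mu, f x = g x) ->
  \int[mu]_x f x = \int[mu]_x g x.
Proof.
move=> fg; rewrite integralE [RHS]integralE; congr (_ - _); apply/eqP;
  rewrite eq_le; apply/andP; split; apply: ge0_ae_le_integralT => //;
  by apply: filterS fg => x fgx; rewrite ?funeposE ?funenegE ?fgx.
Qed.

End IntegralMonotone.

(** By concavity of x^(1/lam) the graph lies below its tangent at s. After division by s this is
    Young's inequality for (x/s)^(1/lam) and 1, with exponents lam and lam/(lam - 1). *)
Lemma powR_inv_le_tangent (R : realType) (lam x s : R) : 1 < lam -> 0 <= x ->
  0 < s -> x `^ lam^-1 <= s `^ lam^-1 * (1 - lam^-1 + lam^-1 * (x / s)).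
Proof.
move=> lam1 x0 s0; have lam0 : 0 < lam by rewrite (lt_trans ltr01).
have y0 : 0 <= x / s by rewrite divr_ge0// ltW.
have l10 : 0 < lam - 1 by rewrite subr_gt0.
have xE : x = s * (x / s) by rewrite mulrC divfK// gt_eqF.
rewrite {1}xE powRM// ?(ltW s0)// ler_wpM2l ?powR_ge0//.
have := @conjugate_powR R ((x / s) `^ lam^-1) 1 lam (lam / (lam - 1)).
rewrite mulr1 powR1 -powRrM mulVf ?gt_eqF// powRr1//.
move=> /(_ (powR_ge0 _ _) ler01 lam0).
rewrite divr_gt0//; set y := _ / s.
have -> : lam^-1 + (lam / (lam - 1))^-1 = 1.
  by field; rewrite !gt_eqF.
move=> /(_ isT erefl)/le_trans; apply.
rewrite le_eqVlt; apply/orP; left; apply/eqP; field.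
by rewrite !gt_eqF.
Qed.

Section HoelderPowR.
Local Open Scope ereal_scope.
Context d (T : measurableType d) (R : realType).
Variable mu : {measure set T -> \bar R}.

(* The tangent lines of the concave function x^(1/lam) replace the usual
   Hoelder inequality, so that h need not be measurable. *)
Lemma hoelder_powR_integral (w : T -> R) (h : T -> R) (A : set T) (K V lam : R) :
  (1 < lam)%R -> (0 <= K)%R -> (0 < V)%R -> measurable A -> mu A <= V%:E ->
  measurable_fun setT w -> (forall x, 0 <= w x)%R ->
  \int[mu]_x (w x)%:E < +oo -> \int[mu]_x (w x)%:E <= \int[mu]_x (h x)%:E ->
  (\forall x \ae mu, (A x -> `|h x| <= K * w x `^ lam^-1)%R /\
                     (~ A x -> h x = 0%R)) ->
  ((fine (\int[mu]_x (w x)%:E)) `^ lam <=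
    K `^ lam * V `^ (lam - 1) * fine (\int[mu]_(x in A) (w x)%:E))%R.
Proof.
move=> lam1 K0 V0 mA muA mw w0 wfin wh hae.
have lam0 : (0 < lam)%R by rewrite (lt_trans ltr01).
have wAw : \int[mu]_(x in A) (w x)%:E <= \int[mu]_x (w x)%:E.
  by apply: ge0_subset_integral => //; [exact/measurable_EFinP|
     move=> x _; rewrite lee_fin].
have wA0 : 0 <= \int[mu]_(x in A) (w x)%:E.
  by apply: integral_ge0 => x _; rewrite lee_fin.
have iw0 : 0 <= \int[mu]_x (w x)%:E.
  by apply: integral_ge0 => x _; rewrite lee_fin.
have wAfin : \int[mu]_(x in A) (w x)%:E \is a fin_num.
  by rewrite ge0_fin_numE//; exact: le_lt_trans wfin.
have iwfin : \int[mu]_x (w x)%:E \is a fin_num by rewrite ge0_fin_numE.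
set I := fine (\int[mu]_(x in A) (w x)%:E).
set F := fine (\int[mu]_x (w x)%:E).
have I0 : (0 <= I)%R by exact: fine_ge0.
have F0 : (0 <= F)%R by exact: fine_ge0.
(* The tangent bound at s is integrated over A; the positive part of h dominates h and vanishes
   almost everywhere off A. *)
have bound s : (0 < s)%R ->
    (F <= K * s `^ lam^-1 * ((1 - lam^-1) * V + lam^-1 / s * I))%R.
  move=> s0; rewrite -lee_fin /F fineK//; apply: (le_trans wh).
  pose t x := (K * (s `^ lam^-1 * (1 - lam^-1 + lam^-1 * (w x / s))))%R.
  have lV : (0 <= 1 - lam^-1)%R by rewrite subr_ge0 invf_le1// ltW.
  have t0 x : (0 <= t x)%R.
    rewrite mulr_ge0// mulr_ge0 ?powR_ge0// addr_ge0//.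
    by rewrite !mulr_ge0// invr_ge0 ltW.
  apply: (@le_trans _ _ (\int[mu]_x ((EFin \o t) \_ A) x)).
    rewrite integralE; apply: (@le_trans _ _ (\int[mu]_x (EFin \o h)^\+ x)).
      rewrite -[leRHS]sube0; apply: leeB => //.
      by apply: integral_ge0.
    apply: ge0_ae_le_integralT => //.
      by apply: erestrict_ge0 => x _; rewrite lee_fin.
    apply: filterS hae => x [hA hAC]; rewrite funeposE patchE /=.
    case: ifPn => [/set_mem xA|]; last first.
      by rewrite notin_setE => /hAC ->; rewrite maxxx.
    rewrite ge_max !lee_fin t0 andbT (le_trans (ler_norm _))//.
    by rewrite (le_trans (hA xA))// ler_wpM2l// powR_inv_le_tangent.
  rewrite -integral_mkcond.
  pose c0 := (K * s `^ lam^-1 * (1 - lam^-1))%R.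
  pose c1 := (K * s `^ lam^-1 * (lam^-1 / s))%R.
  have c00 : (0 <= c0)%R by rewrite mulr_ge0// mulr_ge0// powR_ge0.
  have c10 : (0 <= c1)%R.
    by rewrite /c1 !mulr_ge0 ?powR_ge0 ?invr_ge0 ?(ltW lam0) ?(ltW s0).
  have tE x : (EFin \o t) x = c0%:E + c1%:E * (w x)%:E.
    by rewrite /= /t /c0 /c1 -EFinM -EFinD; congr _%:E; ring.
  under eq_integral do rewrite tE.
  have mwA : measurable_fun A (EFin \o w).
    by apply/measurable_EFinP; exact: measurable_funS mw.
  rewrite ge0_integralD//; last 2 first.
  - by move=> x _; rewrite -EFinM lee_fin mulr_ge0.
  - exact: emeasurable_funM.
  rewrite integral_cst// ge0_integralZl_EFin//; last first.
    by move=> x _; rewrite lee_fin.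
  rewrite -(fineK wAfin) -/I.
  apply: (@le_trans _ _ (c0%:E * V%:E + c1%:E * I%:E)).
    by apply: leeD => //; rewrite lee_wpmul2l// lee_fin.
  rewrite -!EFinM -EFinD lee_fin le_eqVlt; apply/orP; left; apply/eqP.
  by rewrite /c0 /c1; ring.
(* The optimal tangent point is I/V, which may be 0. Any positive J >= I gives the admissible point
   J/V, and J is afterwards lowered to I. *)
have boundI J : (I <= J)%R -> (0 < J)%R ->
    (F `^ lam <= K `^ lam * V `^ (lam - 1) * J)%R.
  move=> IJ J0; have JV0 : (0 < J / V)%R by rewrite divr_gt0.
  have FJ : (F <= K * (J / V) `^ lam^-1 * V)%R.
    apply: (le_trans (bound _ JV0)); rewrite ler_wpM2l ?mulr_ge0 ?powR_ge0//.
    have : (lam^-1 / (J / V) * I <= lam^-1 / (J / V) * J)%R.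
      by rewrite ler_wpM2l// divr_ge0 ?invr_ge0 ?ltW.
    have -> : (lam^-1 / (J / V) * J = lam^-1 * V)%R by field; rewrite !gt_eqF.
    by lra.
  have V0' := ltW V0; have JV0' := ltW JV0.
  have : (F `^ lam <= (K * (J / V) `^ lam^-1 * V) `^ lam)%R.
    by rewrite ge0_ler_powR ?nnegrE ?mulr_ge0 ?powR_ge0// ltW.
  rewrite powRM ?mulr_ge0 ?powR_ge0// powRM ?powR_ge0// -powRrM mulVf ?gt_eqF// powRr1//.
  move=> /le_trans; apply; rewrite -(@mulr_powRB1 _ V lam)//.
  rewrite le_eqVlt; apply/orP; left; apply/eqP; field.
  by rewrite gt_eqF.
set C := (K `^ lam * _)%R; have C0 : (0 <= C)%R by rewrite mulr_ge0// powR_ge0.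
apply/ler_addgt0Pr => e e0.
(* C may vanish, so I is enlarged by e/(C + 1), which costs at most e. *)
have C1 : (0 < C + 1)%R by rewrite ltr_wpDl.
have := boundI (I + e / (C + 1))%R; rewrite lerDl ltr_wpDl ?divr_gt0//.
rewrite ltW ?divr_gt0// => /(_ isT isT)/le_trans; apply.
rewrite mulrDr lerD2l mulrA ler_pdivrMr// mulrDr mulr1 [(C * e)%R]mulrC lerDl.
exact: ltW.
Qed.

End HoelderPowR.

(** The convex function t^(1 - lam) lies above its tangent at F; evaluated at e this bounds (lam -
    1)(F - e) F^(-lam) by the difference of the powers. *)
Lemma powR_gap_le (R : realType) (lam e F Q C : R) : 1 < lam -> 0 < e ->
  e <= F -> Q * F `^ lam <= C * (F - e) ->
  0 <= C -> Q <= C / (lam - 1) * (e `^ (1 - lam) - F `^ (1 - lam)).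
Proof.
move=> lam1 e0 eF QF C0; have F0 : 0 < F by rewrite (lt_le_trans e0).
have l10 : 0 < lam - 1 by rewrite subr_gt0.
have Fl0 : 0 < F `^ lam by rewrite powR_gt0.
have key : (lam - 1) * (F - e) / F `^ lam <= e `^ (1 - lam) - F `^ (1 - lam).
  have -> : e = F * (e / F) by rewrite mulrC divfK// gt_eqF.
  set y := e / F; have y0 : 0 < y by rewrite divr_gt0.
  rewrite powRM ?(ltW F0) ?(ltW y0)//.
  have FE : F `^ (1 - lam) = F / F `^ lam.
    by rewrite powRD ?powRr1 ?powRN ?ltW// (gt_eqF F0) implybT.
  (* Bernoulli's inequality for the negative exponent 1 - lam, from exp z >= 1 + z and ln y <= y -
     1. *)
  have : 1 + (1 - lam) * (y - 1) <= y `^ (1 - lam).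
    rewrite /powR gt_eqF// (le_trans _ (expR_ge1Dx _))// lerD2l.
    have lny : ln y <= y - 1.
      by rewrite -{1}(subrKC 1 y) le_ln1Dx// ltrBrDr addNr.
    by rewrite ler_wnM2l// subr_le0 ltW.
  move=> yl; rewrite FE.
  have -> : (lam - 1) * (F - F * y) / F `^ lam =
     F / F `^ lam * (1 + (1 - lam) * (y - 1)) - F / F `^ lam by ring.
  by rewrite lerD2r ler_wpM2l// divr_ge0// ltW.
have : Q <= C * (F - e) / F `^ lam by rewrite ler_pdivlMr.
move=> /le_trans; apply; rewrite -!mulrA ler_wpM2l//.
by rewrite ler_pdivlMl// mulrA.
Qed.

(** * Sums over geometric intervals *)

Lemma expr_archi (R : realType) (s x : R) : 1 < s -> exists N, x < s ^+ N.
Proof.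
move=> s1; have s10 : 0 < s - 1 by rewrite subr_gt0.
have bern N : N%:R * (s - 1) <= s ^+ N.
  elim: N => [|N ih]; first by rewrite mul0r expr0.
  rewrite exprS; have : 1 <= s ^+ N by rewrite exprn_ege1// ltW.
  move: ih; rewrite -natr1; nra.
exists (Num.truncn (x / (s - 1))).+1; apply: lt_le_trans (bern _).
by rewrite -ltr_pdivrMr// truncnS_gt.
Qed.

Section GeometricIntervals.
Context {R : realType}.
Local Open Scope ereal_scope.

(** The step function equal to c_i on [s^i, s^(i+1)) dominates f on [1, oo); it is integrated term
    by term, and its partial sums stay below B. *)
Lemma integral_geometric_le (f : R -> \bar R) (s B : R) (c : nat -> R) :
  (1 < s)%R -> (forall r, (1 <= r)%R -> 0 <= f r) -> (forall i, 0 <= c i)%R ->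
  (forall i r, (s ^+ i <= r < s ^+ i.+1)%R -> f r <= (c i)%:E) ->
  (forall N, \sum_(i < N) c i * (s ^+ i.+1 - s ^+ i) <= B)%R ->
  \int[@lebesgue_measure R]_(r in `[1%R, +oo[%classic) f r <= B%:E.
Proof.
move=> s1 f0 c0 fc sumB; have s0 : (0 < s)%R by rewrite (lt_trans ltr01).
pose I i : set R := `[(s ^+ i)%R, (s ^+ i.+1)%R[%classic.
have mI i : measurable (I i) by exact: measurable_itv.
pose F i r : \bar R := (c i)%:E * (\1_(I i) r)%:E.
have F0 i r : 0 <= F i r by rewrite mule_ge0 ?lee_fin.
have sub i : I i `<=` `[1%R, +oo[%classic.
  move=> r; rewrite /I /= !in_itv/= andbT => /andP[+ _].
  by apply: le_trans; rewrite exprn_ege1// ltW.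
apply: (@le_trans _ _ (\int[@lebesgue_measure R]_(r in `[1%R, +oo[%classic)
    (\sum_(i <oo) F i r))).
  apply: ge0_le_integral_nonmeasurable => r /=; rewrite in_itv/= andbT => r1.
    exact: f0.
  (* The least N with r < s^(N+1) is the index of the interval containing r. *)
  have /ex_minnP[N rN Nmin] : exists N, (r < s ^+ N.+1)%R.
    have [N rN] := expr_archi r s1; exists N.
    by rewrite (lt_le_trans rN)// ler_weXn2l// ltW.
  have rNI : (s ^+ N <= r < s ^+ N.+1)%R.
    rewrite rN andbT; case: N {rN} Nmin => [|N] Nmin; first by rewrite expr0.
    by rewrite leNgt; apply/negP => /Nmin; rewrite ltnn.
  apply: (le_trans (fc _ _ rNI)).
  apply: le_trans (nneseries_lim_ge N.+1 _) => //.
  rewrite big_mkord big_ord_recr/= [X in _ + X](_ : _ = (c N)%:E).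
    by rewrite leeDr// sume_ge0.
  have rI : I N r by rewrite /I /= in_itv.
  by rewrite /F indicE mem_set// mule1.
rewrite integral_nneseries//; last first.
  move=> i; apply: emeasurable_funM => //; apply/measurable_EFinP.
  by apply: measurable_indic; exact: mI.
apply: lime_le.
  by apply: is_cvg_nneseries => i _ _; apply: integral_ge0 => r _.
near=> N; rewrite big_mkord.
apply: le_trans (_ : (\sum_(i < N) c i * (s ^+ i.+1 - s ^+ i))%R%:E <= _); last first.
  by rewrite lee_fin.
rewrite -sumEFin; apply: lee_sum => i _.
rewrite /F ge0_integralZl_EFin//; last first.
  by apply/measurable_EFinP; apply: measurable_indic; exact: mI.
rewrite integral_indic//; last exact: mI.
rewrite setIidl// EFinM lee_wpmul2l ?lee_fin//.
rewrite /I [leLHS]lebesgue_measure_itv/= lte_fin.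
by rewrite ltr_eXn2l// ltnSn EFinB.
Unshelve. all: by end_near. Qed.

End GeometricIntervals.

(** The shift is 3 because, for r in [sigma^i, sigma^(i+1)), the radii r/sigma and sigma r lie
    between sigma^(i-1) and sigma^(i+2). Three leading terms survive, each at most G j. *)
Lemma telescoping_le (R : realType) (G : nat -> R) (j N : nat) :
  (forall i, 0 <= G i) -> (forall i k, (j <= i)%N -> (i <= k)%N -> G k <= G i) ->
  \sum_(i < N) (G (j + i)%N - G (j + i).+3) <= G j *+ 3.
Proof.
move=> G0 Gd; have -> : \sum_(i < N) (G (j + i)%N - G (j + i).+3) =
    G j + G j.+1 + G j.+2 - G (j + N)%N - G (j + N).+1 - G (j + N).+2.
  elim: N => [|N ih]; first by rewrite big_ord0 addn0; ring.
  by rewrite big_ord_recr/= ih addnS; ring.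
have Gj1 := Gd j j.+1 (leqnn _) (leqnSn _); have Gj2 := Gd j j.+2 (leqnn _) (leqW (leqnSn _)).
have G1 := G0 (j + N)%N; have G2 := G0 (j + N).+1; have G3 := G0 (j + N).+2.
by rewrite !mulrS mulr0n; lra.
Qed.

(** * The a priori estimate *)

(** The exponents of r add up to (m - n) lam + n - m lam + n (lam - 1) = 0, and c cancels against
    c^(-1). The constant from Hoelder's inequality is thus the same at every radius. *)
Lemma scaling_constant (R : realType) (n m : nat) (lam X r c s : R) :
  1 < lam -> 0 < r -> 0 < c -> 0 <= X -> 0 < s ->
  c * r `^ ((m%:R - n%:R) * lam + n%:R) *
    ((X / r ^+ m * c `^ (- lam^-1)) `^ lam * ((s * r) ^+ n) `^ (lam - 1)) =
  X `^ lam * (s ^+ n) `^ (lam - 1).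
Proof.
move=> lam1 r0 c0 X0 s0; have lam0 : 0 < lam by rewrite (lt_trans ltr01).
have rm0 : 0 <= r ^+ m by rewrite exprn_ge0// ltW.
rewrite powRM ?powR_ge0 ?divr_ge0// powRM// ?invr_ge0// -powRrM mulNr mulVf ?gt_eqF//.
rewrite powR_inv1 ?ltW// exprMn powRM ?exprn_ge0 ?ltW//.
have -> : (r ^+ m)^-1 `^ lam = r `^ (- (m%:R * lam)).
  by rewrite -powR_invn ?ltW// -powRrM mulNr.
have -> : (r ^+ n) `^ (lam - 1) = r `^ (n%:R * (lam - 1)).
  by rewrite -powR_mulrn ?ltW// -powRrM.
have : r `^ ((m%:R - n%:R) * lam + n%:R) * r `^ (- (m%:R * lam)) *
    r `^ (n%:R * (lam - 1)) = 1.
  rewrite -!powRD ?(gt_eqF r0) ?implybT//.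
  rewrite [X in r `^ X](_ : _ = 0) ?powRr0//; ring.
set rp := r `^ _; set rm := r `^ _; set rn := r `^ _ => rpmn.
transitivity (X `^ lam * (s ^+ n) `^ (lam - 1) * (rp * rm * rn)).
  by field; rewrite gt_eqF.
by rewrite rpmn mulr1.
Qed.

Section SolutionEstimate.
Context {R : realType} {n m : nat}.

Lemma ae_lebn_sub (P Q : set (Rn_space R n)) :
  almost_everywhere (lebn R n) P -> P `<=` Q ->
  almost_everywhere (lebn R n) Q.
Proof. by move=> aP PQ; exact: filterS aP. Qed.

Lemma ae_lebn_and (P Q : set (Rn_space R n)) :
  almost_everywhere (lebn R n) P -> almost_everywhere (lebn R n) Q ->
  almost_everywhere (lebn R n) (P `&` Q).
Proof. by move=> aP aQ; exact: filterI. Qed.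

(** The absolute value of a Borel representative is non-negative at every point, not just almost
    everywhere, as the later integrals demand. *)
Lemma Lloc1_measurable_version (f : 'rV[R]_n -> R) : (forall x, 0 <= f x) ->
  Lloc1 f -> exists g : Rn_space R n -> R, [/\ measurable_fun setT g,
    forall y, 0 <= g y, \forall y \ae lebn R n, f (of_nested y) = g y &
    forall r, 0 < r -> (\int[lebn R n]_(y in nested_ball r) (g y)%:E < +oo)%E].
Proof.
move=> f0 [[g0 [mg0 fg0]] ffin].
have fg : \forall y \ae lebn R n, f (of_nested y) = `|g0 (of_nested y)|.
  by apply: (ae_lebn_sub fg0) => y /= fy; rewrite -fy ger0_norm.
exists (fun y => `|g0 (of_nested y)|); split => //.
  exact: (measurableT_comp (@normr_measurable R setT) mg0).
move=> r r0; have <- : (\int[lebn R n]_(y in nested_ball r) (`|f (of_nested y)|)%:E =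
    \int[lebn R n]_(y in nested_ball r) (`|g0 (of_nested y)|)%:E)%E.
  rewrite integral_mkcond [RHS]integral_mkcond; apply: ae_eq_integralT.
  apply: (ae_lebn_sub fg) => y /= fy; rewrite !patchE; case: ifP => // _.
  by rewrite fy normr_id.
exact: ffin.
Qed.

Variables (lam sigma : R) (A : multi_index n m -> 'rV[R]_n -> R -> R).
Variables (a b u : 'rV[R]_n -> R).
Hypotheses (n0 : (0 < n)%N) (m0 : (0 < m)%N) (lam1 : 1 < lam).
Hypotheses (sigma1 : 1 < sigma) (a0 : forall x, 0 < a x).
Hypothesis Aa : ae_Rn (fun x => forall (al : multi_index n m) (z : R),
  mi_deg al = m -> `|A al x z| <= a x * `|z|).
Hypothesis u_sol : is_solution A b lam u.

(** Raised to the power lam, the claim reads a^lam |u|^lam <= c^(-1) b |u|^lam, which is the assumed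
    bound on c. *)
Lemma coefficient_le (x : 'rV[R]_n) (c : R) : 0 < c ->
  c <= a x `^ (- lam) * b x ->
  a x * `|u x| <= c `^ (- lam^-1) * (b x * `|u x| `^ lam) `^ lam^-1.
Proof.
move=> c0 cab; have lam0 : 0 < lam by rewrite (lt_trans ltr01).
have ax0 := ltW (a0 x).
have alam : 0 < a x `^ lam by rewrite powR_gt0.
have key : (a x * `|u x|) `^ lam <= c^-1 * (b x * `|u x| `^ lam).
  rewrite powRM// mulrA ler_wpM2r ?powR_ge0//.
  rewrite ler_pdivlMl// -ler_pdivlMr//.
  by rewrite [b x / _]mulrC -powRN.
have b0 : 0 <= b x * `|u x| `^ lam.
  have : 0 <= c^-1 * (b x * `|u x| `^ lam) by rewrite (le_trans _ key)// powR_ge0.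
  by rewrite pmulr_rge0 ?invr_gt0.
have -> : a x * `|u x| = ((a x * `|u x|) `^ lam) `^ lam^-1.
  by rewrite -powRrM mulfV ?gt_eqF// powRr1// mulr_ge0.
have -> : c `^ (- lam^-1) = c^-1 `^ lam^-1.
  by rewrite -(powR_inv1 (ltW c0)) -powRrM mulN1r.
rewrite -powRM ?invr_ge0 ?(ltW c0)//.
apply: ge0_ler_powR; rewrite ?nnegrE ?powR_ge0//; first by rewrite invr_ge0 ltW.
by rewrite mulr_ge0// invr_ge0 ltW.
Qed.

(** C is fixed before r and c, so one constant serves all annuli and all lower bounds. The witness F
    is the integral of g times the test function at radius r. *)
Lemma solution_estimate (g : Rn_space R n -> R) : measurable_fun setT g ->
  (forall y, 0 <= g y) ->
  (\forall y \ae lebn R n, b (of_nested y) * `|u (of_nested y)| `^ lam = g y) ->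
  (forall r, 0 < r -> (\int[lebn R n]_(y in nested_ball r) (g y)%:E < +oo)%E) ->
  let E r := fine (\int[lebn R n]_(y in nested_ball r) (g y)%:E)%E in
  exists2 C : R, 0 <= C & forall r c, 0 < r -> 0 < c ->
    ae_Rn (fun x => annulus sigma r x -> c <= a x `^ (- lam) * b x) ->
  exists F, [/\ E (r / sigma) <= F, F <= E (sigma * r) &
    c * r `^ ((m%:R - n%:R) * lam + n%:R) * F `^ lam <= C * (F - E (r / sigma))].
Proof.
move=> mg g0 ug gfin E.
have sigma0 : 0 < sigma by rewrite (lt_trans ltr01).
have [K K0 HK] := @exists_scaled_test_fun R n m lam sigma m0 lam1 sigma1.
(* M counts the multi-indices of degree m. In the constant below, sigma + sigma is the side, up to
   the factor r, of the cube around the outer ball. *)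
pose M : R := \sum_(al : multi_index n m | mi_deg al == m) 1.
have M0 : 0 <= M by apply: sumr_ge0.
exists ((M * K) `^ lam * ((sigma + sigma) ^+ n) `^ (lam - 1)).
  by rewrite mulr_ge0// powR_ge0.
move=> r c r0 c0 cab.
have [phi [sphi phi01 phi1 phi0 phiD]] := HK r r0.
have phi_ge0 x : 0 <= phi x by have /andP[] := phi01 x.
pose w y := g y * phi (of_nested y).
pose h y := \sum_(al : multi_index n m | mi_deg al == m)
  A al (of_nested y) (u (of_nested y)) * mpartial al phi (of_nested y).
pose D := nested_ball (sigma * r) `\` nested_ball (r / sigma) : set (Rn_space R n).
have sr0 : 0 < sigma * r by rewrite mulr_gt0.
have rs0 : 0 < r / sigma by rewrite divr_gt0.
have mB := @measurable_nested_ball R n.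
have mD : measurable D by exact: measurableD.
have w0 y : 0 <= w y by rewrite mulr_ge0.
have mw : measurable_fun setT w.
  by apply: measurable_funM => //; exact: smooth_expr_measurable.
have rs_sr : r / sigma <= sigma * r.
  rewrite ler_pdivrMr// mulrC mulrA ler_peMl ?ltW//.
  by rewrite -expr2 exprn_egt1.
have BB : (nested_ball (r / sigma) : set (Rn_space R n)) `<=`
    nested_ball (sigma * r).
  by move=> y; rewrite /nested_ball /= => /lt_le_trans; exact.
have wball : (\int[lebn R n]_y (w y)%:E =
    \int[lebn R n]_(y in nested_ball (sigma * r)) (w y)%:E)%E.
  rewrite [RHS]integral_mkcond; apply: eq_integral => y _; rewrite patchE.
  case: ifPn => //; rewrite notin_setE /nested_ball/= => /negP.
  by rewrite -leNgt => /phi0 py; rewrite /w py mulr0.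
have wE : (\int[lebn R n]_y (w y)%:E <=
    \int[lebn R n]_(y in nested_ball (sigma * r)) (g y)%:E)%E.
  rewrite wball; apply: ge0_le_integral_nonmeasurable => y _; rewrite lee_fin//.
  by rewrite ler_piMr//; have /andP[] := phi01 (of_nested y).
have gsr := gfin _ sr0.
have wfin : (\int[lebn R n]_y (w y)%:E < +oo)%E by exact: le_lt_trans gsr.
have muD : (lebn R n D <= (((sigma + sigma) * r) ^+ n)%:E)%E.
  apply: (@le_trans _ _ (lebn R n (nested_ball (sigma * r)))).
    by apply: le_measure; rewrite ?inE//; exact: subDsetl.
  by rewrite mulrDl; apply: nested_ball_measure => //; exact: ltW.
have wh : (\int[lebn R n]_y (w y)%:E <= \int[lebn R n]_y (h y)%:E)%E.
  have [_ [_ /(_ phi)]] := u_sol.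
  have phi_test : nonneg_test_fun phi.
    split; first exact: smooth_expr_smooth.
    by split => //; exists (sigma * r) => x /ltW; exact: phi0.
  move=> /(_ phi_test); rewrite {2}/integral_Rn => /(le_trans _); apply.
  rewrite /integral_Rn le_eqVlt; apply/orP; left; apply/eqP.
  by apply: ae_eq_integralT; apply: (ae_lebn_sub ug) => y /= ugy; rewrite ugy.
have hae : \forall y \ae lebn R n,
    (D y -> `|h y| <= M * K / r ^+ m * c `^ (- lam^-1) * w y `^ lam^-1) /\
    (~ D y -> h y = 0).
  apply: (ae_lebn_sub (ae_lebn_and Aa (ae_lebn_and ug cab))).
  move=> y /= [Ay [ugy cy]]; split.
    move=> [yD1 yD2]; rewrite /h (le_trans (ler_norm_sum _ _ _))//.
    have := coefficient_le c0 (cy (conj yD1 yD2)); rewrite ugy => auy.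
    apply: (@le_trans _ _ (\sum_(al : multi_index n m | mi_deg al == m)
        1 * (K / r ^+ m * c `^ (- lam^-1) * w y `^ lam^-1))).
      apply: ler_sum => al /eqP alm; rewrite mul1r normrM.
      have [pD _] := phiD al alm (of_nested y).
      have Aal := le_trans (Ay al (u (of_nested y)) alm) auy.
      apply: (le_trans (ler_pM _ _ Aal pD)) => //.
      rewrite /w powRM// le_eqVlt; apply/orP; left; apply/eqP; ring.
    rewrite -mulr_suml -/M le_eqVlt; apply/orP; left; apply/eqP; ring.
  (* Off the annulus every derivative vanishes: inside, because the test function is constant;
     outside, because the bound by phi^(1/lam) is 0. *)
  move=> nD; rewrite /h big1// => al /eqP alm.
  have [pD pD0] := phiD al alm (of_nested y).
  suff -> : mpartial al phi (of_nested y) = 0 by rewrite mulr0.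
  have [yin|yin] := ltP (eucl (of_nested y)) (r / sigma); first exact: pD0.
  have [yout|yout] := leP (sigma * r) (eucl (of_nested y)); last first.
    by exfalso; apply: nD; split => //; rewrite /nested_ball/= ltNge yin.
  move: pD; rewrite phi0// powR0 ?mulr0 ?invr_eq0 ?gt_eqF ?(lt_trans ltr01)//.
  by rewrite normr_le0 => /eqP.
have K'0 : 0 <= M * K / r ^+ m * c `^ (- lam^-1).
  by rewrite !mulr_ge0 ?powR_ge0// invr_ge0 exprn_ge0// ltW.
have V0 : 0 < ((sigma + sigma) * r) ^+ n.
  by rewrite exprn_gt0// mulr_gt0// addr_gt0.
have := hoelder_powR_integral lam1 K'0 V0 mD muD mw w0 wfin wh hae.
set F := fine _; set I := fine _ => FI.
have intB s : 0 < s -> (\int[lebn R n]_(y in nested_ball s) (g y)%:E)%E \is a fin_num.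
  move=> s0; rewrite ge0_fin_numE; first exact: gfin.
  by apply: integral_ge0 => y _; rewrite lee_fin.
(* The test function is 1 on the inner ball, so F - E(r/sigma) is exactly the integral I over the
   annulus. *)
have FE : F = E (r / sigma) + I.
  have wD : (\int[lebn R n]_(y in D) (w y)%:E <= \int[lebn R n]_y (w y)%:E)%E.
    by apply: ge0_subset_integral => //; [exact/measurable_EFinP|
       move=> y _; rewrite lee_fin].
  have wD0 : (0 <= \int[lebn R n]_(y in D) (w y)%:E)%E.
    by apply: integral_ge0 => y _; rewrite lee_fin.
  rewrite /F wball -(setDUK BB) ge0_integral_setU//; last 3 first.
  - by apply/measurable_EFinP; exact: measurable_funS mw.
  - by move=> y _; rewrite lee_fin.
  - by rewrite disj_set2E setDIK.
  rewrite (_ : (\int[lebn R n]_(y in nested_ball (r / sigma)) (w y)%:E)%E =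
     (\int[lebn R n]_(y in nested_ball (r / sigma)) (g y)%:E)%E).
    by rewrite fineD// ?intB// ge0_fin_numE//; exact: le_lt_trans wfin.
  by apply: eq_integral => y /set_mem yB; rewrite /w phi1 ?mulr1.
exists F; split.
- by rewrite FE lerDl fine_ge0//; apply: integral_ge0 => y _; rewrite lee_fin.
- by apply: fine_le => //; [rewrite ge0_fin_numE// integral_ge0// => y _;
    rewrite lee_fin|exact: intB].
- have -> : F - E (r / sigma) = I by rewrite FE addrC addKr.
  have s20 : 0 < sigma + sigma by rewrite addr_gt0.
  rewrite -(@scaling_constant R n m lam (M * K) r c _ lam1 r0 c0 _ s20) ?mulr_ge0//.
  by rewrite -[leRHS]mulrA ler_wpM2l// mulr_ge0 ?powR_ge0// ltW.
Qed.

End SolutionEstimate.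

(** * Essential lower bounds on annuli *)

Section EssentialInfimum.
Context {R : realType} {n : nat}.
Implicit Types (f : 'rV[R]_n -> R) (E : set 'rV[R]_n).

Lemma ess_inf_on_ge0 E f : (forall x, 0 <= f x) -> (0 <= ess_inf_on E f)%E.
Proof. by move=> f0; apply: ereal_sup_ubound; apply: aeW => y _; rewrite lee_fin. Qed.

(** The supremum runs over extended reals, but a bound above Y, even an infinite one, yields a real
    lower bound still above Y. *)
Lemma ess_inf_on_le E f (Y : R) : 0 <= Y ->
  (forall c, 0 < c -> ae_Rn (fun x => E x -> c <= f x) -> c <= Y) ->
  (ess_inf_on E f <= Y%:E)%E.
Proof.
move=> Y0 HY; apply: ge_ereal_sup => c /= cE; rewrite leNgt; apply/negP => Yc.
have [c' Yc' c'c] : exists2 c', Y < c' & (c'%:E <= c)%E.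
  case: c cE Yc => [c| |] // _ Yc; first by exists c.
  by exists (Y + 1); rewrite ?ltrDl ?leey.
have := HY c' (le_lt_trans Y0 Yc'); rewrite leNgt Yc' => /(_ _)/notF; apply.
apply: (ae_lebn_sub cE) => y /= cy /cy; rewrite -lee_fin; exact: le_trans.
Qed.

(** If every k were an essential lower bound, the real-valued f would exceed all integers almost
    everywhere on an annulus of positive measure. *)
Lemma not_ae_le_nat f (s t : R) : (0 < n)%N -> 0 <= s -> s < t ->
  exists k : nat, ~ ae_Rn (fun x => s <= eucl x < t -> k%:R <= f x).
Proof.
move=> n0 s0 st; apply/existsNP => fk.
apply: (annulus_not_ae_empty n0 s0 st).
apply: (ae_lebn_sub (ae_foralln fk)) => y /= fy yst.
have := fy (Num.truncn (f (of_nested y))).+1 yst.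
by rewrite leNgt truncnS_gt.
Qed.

End EssentialInfimum.

(** * Divergence of the integral and vanishing of solutions *)

Theorem theorem2p1 (R : realType) (n m : nat) (lam : R)
    (A : multi_index n m -> 'rV[R]_n -> R -> R)
    (a b : 'rV[R]_n -> R) (sigma : R) :
  (0 < n)%N -> (0 < m)%N -> 1 < lam ->
  Rn_measurable b -> (forall x, 0 < b x) ->
  Rn_measurable a -> (forall x, 0 < a x) ->
  ae_Rn (fun x => forall (al : multi_index n m) (z : R),
           mi_deg al = m -> `|A al x z| <= a x * `|z|) ->
  1 < sigma ->
  (\int[@lebesgue_measure R]_(r in `[1%R, +oo[%classic)
      ((r `^ ((m%:R - n%:R) * lam + n%:R - 1))%:E *
       ess_inf_on (@annulus R n sigma r) (fun x => a x `^ (- lam) * b x)%R))%E = +oo%E ->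
  forall u : 'rV[R]_n -> R, is_solution A b lam u ->
    ae_Rn (fun x => u x = 0).
Proof.
move=> n0 m0 lam1 _ b0 _ a0 Aa sigma1 int_oo u u_sol.
have lam0 : 0 < lam by rewrite (lt_trans ltr01).
have sigma0 : 0 < sigma by rewrite (lt_trans ltr01).
have s0 i : 0 < sigma ^+ i by rewrite exprn_gt0.
have sX i k : (i <= k)%N -> sigma ^+ i <= sigma ^+ k.
  by move=> ik; rewrite ler_weXn2l// ltW.
have bu0 x : 0 <= b x * `|u x| `^ lam by rewrite mulr_ge0 ?powR_ge0// ltW.
have [g [mg g0 bug gfin]] := Lloc1_measurable_version bu0 (proj1 u_sol).
pose E r := fine (\int[lebn R n]_(y in nested_ball r) (g y)%:E)%E.
have intE0 r : (0 <= \int[lebn R n]_(y in nested_ball r) (g y)%:E)%E.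
  by apply: integral_ge0 => y _; rewrite lee_fin.
have intE r : 0 < r -> (\int[lebn R n]_(y in nested_ball r) (g y)%:E)%E \is a fin_num.
  by move=> r0; rewrite ge0_fin_numE//; exact: gfin.
have E_ge0 r : 0 <= E r by exact: fine_ge0.
have E_mono r s : 0 < r -> r <= s -> E r <= E s.
  move=> r0 rs; apply: fine_le; [exact: intE|exact/intE/(lt_le_trans r0)|].
  apply: ge0_subset_integral; [exact: measurable_nested_ball|
    exact: measurable_nested_ball| | |].
  - by apply/measurable_EFinP; exact: measurable_funS mg.
  - by move=> y _; rewrite lee_fin.
  - by move=> y; rewrite /nested_ball/= => /lt_le_trans; exact.
have [C C0 HC] := solution_estimate n0 m0 lam1 sigma1 a0 Aa u_sol mg g0 bug gfin.
rewrite -/E in HC.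
set p := (m%:R - n%:R) * lam + n%:R in HC.
pose f x := a x `^ (- lam) * b x.
have f0 x : 0 <= f x by rewrite mulr_ge0 ?powR_ge0// ltW.
(* If E(s) > 0, then E is positive from the radius sigma^j on, and the divergent integral gets a
   finite bound. *)
have E_eq0 s : 0 < s -> E s = 0.
  move=> sp; apply/eqP; rewrite eq_le E_ge0 andbT leNgt; apply/negP => Es.
  have [j sj] := expr_archi s sigma1.
  pose G i := E (sigma ^+ i) `^ (1 - lam).
  have Epos i : (j <= i)%N -> 0 < E (sigma ^+ i).
    move=> ji; apply: (lt_le_trans Es); apply: E_mono => //.
    by rewrite (le_trans (ltW sj))// sX.
  have pow_anti x y : 0 < x -> x <= y -> y `^ (1 - lam) <= x `^ (1 - lam).
    move=> x0 xy; rewrite -(opprB lam 1) !powRN lef_pV2 ?posrE ?powR_gt0//.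
      apply: ge0_ler_powR => //; rewrite ?nnegrE ?subr_ge0 ?ltW//.
      exact: lt_le_trans xy.
    exact: lt_le_trans xy.
  pose C' := C / (lam - 1).
  have C'0 : 0 <= C' by rewrite divr_ge0// subr_ge0 ltW.
  pose F r : \bar R := ((r `^ (p - 1))%:E * ess_inf_on (annulus sigma r) f)%E.
  have F_le r Y : 1 <= r -> 0 <= Y -> (forall c, 0 < c ->
      ae_Rn (fun x => annulus sigma r x -> c <= f x) -> c * r `^ p <= Y) ->
      (F r <= (Y / r)%:E)%E.
    move=> r1 Y0 HY; have r0 : 0 < r by rewrite (lt_le_trans ltr01).
    have rp : r `^ p = r `^ (p - 1) * r.
      rewrite -[in X in _ * X](powRr1 (ltW r0)) -powRD ?subrK//.
      by rewrite (gt_eqF r0) implybT.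
    have rp0 : 0 < r `^ (p - 1) by rewrite powR_gt0.
    apply: (@le_trans _ _ ((r `^ (p - 1))%:E * (Y / r / r `^ (p - 1))%:E)%E).
      apply: lee_wpmul2l; first by rewrite lee_fin ltW.
      apply: ess_inf_on_le => [|c c0 /(HY c c0)].
        by rewrite !divr_ge0// ltW.
      by rewrite !ler_pdivlMr// rp mulrA.
    by rewrite -EFinM lee_fin mulrC divfK// gt_eqF.
  (* For every r in the interval, the shell sigma^i <= |x| < sigma^(i+1) lies in the annulus of r,
     so one k caps all its lower bounds. The exponent [|p|] covers negative p, as r >= 1. *)
  have early i : exists M, 0 <= M /\
      forall r, sigma ^+ i <= r < sigma ^+ i.+1 -> (F r <= M%:E)%E.
    have [|k nk] := @not_ae_le_nat R n f (sigma ^+ i) (sigma ^+ i.+1) n0 (ltW (s0 _)).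
      by rewrite ltr_eXn2l.
    exists (k%:R * (sigma ^+ i.+1) `^ `|p|); split.
      by rewrite mulr_ge0 ?powR_ge0.
    move=> r /andP[ir ri].
    have r1 : 1 <= r by rewrite (le_trans _ ir)// exprn_ege1// ltW.
    have r0 : 0 < r by rewrite (lt_le_trans ltr01).
    apply: le_trans (F_le r (k%:R * (sigma ^+ i.+1) `^ `|p|) r1 _ _) _.
    - by rewrite mulr_ge0 ?powR_ge0.
    - move=> c c0 cf; apply: ler_pM; rewrite ?(ltW c0) ?powR_ge0//.
        rewrite leNgt; apply/negP => kc; apply: nk.
        apply: (ae_lebn_sub cf) => y /= fy /andP[iy yi].
        apply: le_trans (ltW kc) (fy _); split; rewrite /ball_Rn/=.
          by apply: (lt_le_trans yi); rewrite exprS ler_wpM2l// ltW.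
        apply/negP; rewrite -leNgt (le_trans _ iy)// ler_pdivrMr// -exprSr.
        exact: ltW.
      apply: (@le_trans _ _ (r `^ `|p|)).
        by apply: ler_powR => //; exact: ler_norm.
      by apply: ge0_ler_powR; rewrite ?nnegrE ?normr_ge0 ?ltW.
    - by rewrite lee_fin ler_pdivrMr// ler_peMr// mulr_ge0 ?powR_ge0.
  (* The index starts at j + 1 so that r/sigma >= sigma^j, where E is already positive. *)
  have late k r : sigma ^+ (j + k).+1 <= r < sigma ^+ (j + k).+2 ->
      (F r <= (C' * (G (j + k)%N - G (j + k).+3) / sigma ^+ (j + k).+1)%:E)%E.
    move=> /andP[ir ri].
    have r1 : 1 <= r by rewrite (le_trans _ ir)// exprn_ege1// ltW.
    have r0 : 0 < r by rewrite (lt_le_trans ltr01).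
    have jk := Epos _ (leq_addr k j).
    have Gk0 : 0 <= C' * (G (j + k)%N - G (j + k).+3).
      rewrite mulr_ge0// subr_ge0; apply: pow_anti => //.
      by apply: E_mono => //; apply: sX; do 3!apply: leqW.
    have E1 : E (sigma ^+ (j + k)) <= E (r / sigma).
      by apply: E_mono => //; rewrite ler_pdivlMr// -exprSr.
    apply: le_trans (F_le r _ r1 Gk0 _) _ => [c c0 cf|].
      have [F' [EF FE QF]] := HC r c r0 c0 cf.
      have e0 : 0 < E (r / sigma) by exact: lt_le_trans E1.
      apply: (le_trans (powR_gap_le lam1 e0 EF QF C0)); rewrite -/C'.
      rewrite ler_wpM2l// lerB//; first exact: pow_anti.
      apply: pow_anti; first exact: lt_le_trans EF.
      apply: (le_trans FE); apply: E_mono; first by rewrite mulr_gt0.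
      by rewrite exprS ler_wpM2l// ltW.
    by rewrite lee_fin ler_wpM2l// lef_pV2 ?posrE.
  have [M /all_and2[M0 HM]] := choice early.
  pose c i := if (i < j.+1)%N then M i else
    C' * (G i.-1 - G i.+2) / sigma ^+ i.
  have c0 i : 0 <= c i.
    rewrite /c; case: ltnP => // ji; rewrite divr_ge0 ?(ltW (s0 _))// mulr_ge0// subr_ge0.
    have i0 : (0 < i)%N by exact: leq_trans ji.
    apply: pow_anti; first by apply: Epos; rewrite -ltnS prednK.
    by apply: E_mono => //; apply: sX; do 2!apply: leqW; exact: leq_pred.
  (* The interval length divided by sigma^i is sigma - 1, so the late terms are C' (sigma - 1) times
     a telescoping sum bounded by 3 G j. *)
  pose B := \sum_(i < j.+1) c i * (sigma ^+ i.+1 - sigma ^+ i) +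
            C' * (sigma - 1) * (G j *+ 3).
  suff : (\int[@lebesgue_measure R]_(r in `[1%R, +oo[%classic) F r <= B%:E)%E.
    by rewrite /F /p int_oo.
  apply: (@integral_geometric_le _ F sigma B c) => //.
  - by move=> r _; rewrite mule_ge0 ?lee_fin ?powR_ge0// ess_inf_on_ge0.
  - move=> i r ir; rewrite /c; case: ltnP => ji; first exact: HM.
    have iE : i = (j + (i - j.+1)).+1 by rewrite -addSn subnKC.
    by rewrite iE /=; apply: late; rewrite -iE.
  - move=> N; pose d i := c i * (sigma ^+ i.+1 - sigma ^+ i).
    have d0 i : 0 <= d i by rewrite mulr_ge0// subr_ge0 sX.
    (* Enlarging the range by non-negative terms ensures that all early intervals are included,
       whatever N is. *)
    apply: (@le_trans _ _ (\sum_(i < j.+1 + N) d i)).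
      rewrite -!(big_mkord xpredT d) [leRHS](big_cat_nat _ (n := N))//=.
        by rewrite lerDl; apply: sumr_ge0.
      by rewrite leq_addl.
    rewrite big_split_ord/= lerD2l.
    have -> : \sum_(i < N) d (j.+1 + i)%N =
        C' * (sigma - 1) * \sum_(i < N) (G (j + i)%N - G (j + i).+3).
      rewrite mulr_sumr; apply: eq_bigr => i _; rewrite /d /c ltnNge leq_addr/=.
      rewrite addSn/= [sigma ^+ (j + i).+2]exprS; field.
      by rewrite gt_eqF.
    have Cs0 : 0 <= C' * (sigma - 1) by rewrite mulr_ge0// subr_ge0 ltW.
    apply: ler_wpM2l => //.
    apply: (@telescoping_le R G j N) => [i|i k ji ik]; first exact: powR_ge0.
    by apply: pow_anti; [exact: Epos|apply: E_mono => //; exact: sX].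
(* E vanishes at all radii, so g is zero almost everywhere on each ball of integer radius; these
   countably many balls cover the space, and b > 0 then forces u = 0. *)
have g_ae0 k : \forall y \ae lebn R n, nested_ball k.+1%:R y -> g y = 0.
  have := @ae_eq_integral_abs _ _ _ (lebn R n) (nested_ball k.+1%:R)
    (@measurable_nested_ball R n _) (EFin \o g).
  move=> [|+ _].
    by apply/measurable_EFinP; exact: measurable_funS mg.
  have -> : (\int[lebn R n]_(y in nested_ball k.+1%:R) `|(EFin \o g) y| = 0)%E.
    under eq_integral do rewrite /= ger0_norm//.
    by rewrite -[LHS]fineK ?intE// [fine _]E_eq0.
  move=> /(_ erefl) aeg; apply: (ae_lebn_sub aeg) => y /= gy /gy.
  by case.
apply: (ae_lebn_sub (ae_lebn_and bug (ae_foralln g_ae0))) => y /= [buy gy].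
have g_y : g y = 0.
  by apply: (gy (Num.truncn (eucl (of_nested y)))); exact: truncnS_gt.
apply/eqP; move/eqP: buy; rewrite g_y mulf_eq0 gt_eqF//= powR_eq0 normr_eq0.
by case/andP.
Qed.
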